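(* The adaptivity gap of stochastic orienteering is $\Omega\left((\log\log B)^{1/2}\right)$, even on a line metric. That is, there is an absolute constant $c>0$ such that for arbitrarily large budgets $B$ there exist instances of stochastic orienteering with budget $B$ whose underlying metric is a line metric (points on the real line with distance $|x-y|$) for which the maximum expected reward of an adaptive policy is at least $c\,\sqrt{\log\log B}$ times the maximum expected reward of a non-adaptive policy.
   Context: Stochastic orienteering: the input is a metric $(V,d)$ with symmetric nonnegative integer distances (travel times) satisfying the triangle inequality, a root vertex $\rho\in V$, and an integer budget $B$. Each vertex $v$ holds a job with a deterministic reward $r_v\ge 0$ and a random integer processing time (size) $S_v$ with known distribution; sizes are independent across vertices. A policy starts at $\rho$, travels to vertices and runs their jobs non-preemptively; the size of a job is learned only upon its completion. A job's reward is collected iff the total time elapsed (distance travelled plus sizes of all jobs processed so far, including this one) is at most $B$. An adaptive policy may choose the next vertex based on the sizes observed so far (a decision tree); a non-adaptive policy is a fixed path from $\rho$ whose vertices are processed in order until the budget is exhausted. The adaptivity gap is the worst-case ratio of the optimal adaptive expected reward to the optimal non-adaptive expected reward. *)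

(* Defs.v *)
From mathcomp Require Import all_boot all_order all_algebra.
From mathcomp Require Import all_classical all_reals all_analysis.

Set Implicit Arguments.
Unset Strict Implicit.
Unset Printing Implicit Defensive.

Import Order.TTheory GRing.Theory Num.Theory.

Local Open Scope classical_set_scope.
Local Open Scope ring_scope.

Record orienteering (R : realType) := Orienteering {
  vertex : finType;
  travel : vertex -> vertex -> nat;
  root_vertex : vertex;
  budget : nat;
  reward : vertex -> R;
  size_pmf : vertex -> nat -> R;
  travel_eq0 : forall u v, (travel u v == 0%N) = (u == v);
  travel_sym : forall u v, travel u v = travel v u;
  travel_triangle : forall u v w, (travel u w <= travel u v + travel v w)%N;
  reward_ge0 : forall v, 0 <= reward v;
  size_pmf_ge0 : forall v k, 0 <= size_pmf v k;
  size_pmf_sum1 : forall v, \esum_(k in [set: nat]) (size_pmf v k)%:E = 1%E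
}.

Definition line_metric (R : realType) (I : orienteering R) : Prop :=
  exists x : vertex I -> R, forall u v, (travel u v)%:R = `|x u - x v|.

(* [Visit v next] travels to [v], runs its job and, if the job turns out to
   have size [k], goes on with [next k]. *)
Inductive policy (V : Type) : Type :=
| Stop
| Visit of V & (nat -> policy V).

Arguments Stop {V}.

(* No branch runs a job twice, nor runs a job in [done]. *)
Fixpoint runs_once (V : eqType) (done : seq V) (T : policy V) : Prop :=
  match T with
  | Stop => True
  | Visit v next =>
      v \notin done /\ forall k : nat, runs_once (v :: done) (next k)
  end.

Fixpoint path_policy (V : Type) (p : seq V) : policy V :=
  if p is v :: p' then Visit v (fun _ => path_policy p') else Stop.

(* Reward collected by [T], started at vertex [u] when the elapsed time is [t],
   if the sizes are given by [s]. A job finishing after the budget contributes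
   nothing, and so do all later ones, as the elapsed time never decreases. *)
Fixpoint collected (R : realType) (I : orienteering R) (s : vertex I -> nat)
    (u : vertex I) (t : nat) (T : policy (vertex I)) : R :=
  match T with
  | Stop => 0
  | Visit v next =>
      let t' := (t + travel u v + s v)%N in
      (if (t' <= budget I)%N then reward v else 0) +
      collected s v t' (next (s v))
  end.

(* Expectation over the size profiles [s]; by independence, the probability of
   [s] is the product of the marginal probabilities. *)
Definition expected_reward (R : realType) (I : orienteering R)
    (T : policy (vertex I)) : \bar R :=
  \esum_(s in [set: {ffun vertex I -> nat}])
    ((\prod_(v : vertex I) size_pmf v (s v)) * collected s (root_vertex I) 0%N T)%:E.

Definition adaptive_opt (R : realType) (I : orienteering R) : \bar R :=
  ereal_sup [set expected_reward T | T in [set T : policy (vertex I) |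
    runs_once [::] T]].

Definition nonadaptive_opt (R : realType) (I : orienteering R) : \bar R :=
  ereal_sup [set expected_reward (path_policy p) | p in
    [set p : seq (vertex I) | uniq p]].

(* Main.v *)
(* Take a binary tree of height H whose nodes carry jobs of positive size with
   probability p and of size 0 otherwise. After a size 0 the adaptive policy
   moves to the far child, after a positive size to the near one; the reward of a
   node is (1 - p)^k, where k is the number of near edges above it, so each level
   multiplies the expected reward by (1 - p) + p (1 - p) = 1 - p^2. The nodes lie
   on a line in the preorder (node, near subtree, far subtree) with exponentially
   decreasing distance to the end of the budget: a job of positive size makes all
   later nodes but its near subtree unreachable, and going back on the line
   exhausts the budget. On a fixed path, every job preceding a node v therefore
   contributes a factor 1 - p, either to the reward of v or to the probability of
   collecting it, so the path earns at most the sum of the (1 - p)^j, i.e. 1 / p.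
   With H = m^2 and p = 1 / (2 m) the ratio is of order m, while ln (ln B) is of
   order H = m^2. *)

Require Import Defs.
From mathcomp Require Import all_boot all_order all_algebra.
From mathcomp Require Import all_classical all_reals all_analysis.
From mathcomp Require Import zify ring lra.

Set Implicit Arguments.
Unset Strict Implicit.
Unset Printing Implicit Defensive.

Import Order.TTheory GRing.Theory Num.Theory.

Local Open Scope ring_scope.

(** * Finitely supported sums and independent two-point sizes *)

Lemma esum_seq (R : realType) (T : choiceType) (r : seq T) (a : T -> R) :
  uniq r -> (forall i, 0 <= a i) -> (forall i, i \notin r -> a i = 0) ->
  \esum_(i in [set: T]) (a i)%:E = (\sum_(i <- r) a i)%:E.
Proof.
move=> r_uniq a_ge0 a_supp.
have -> : \esum_(i in [set: T]) (a i)%:E = \esum_(i in [set` r]) (a i)%:E.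
  rewrite [RHS]esum_mkcond; apply: eq_esum => i _.
  by rewrite mem_setE; case: ifPn => // /a_supp ->.
rewrite esum_fset //; last by move=> i _; rewrite lee_fin.
by rewrite -fsbig_seq // sumEFin.
Qed.

Section TwoPointSizes.
Variables (R : realType) (p : R) (T : finType) (S : T -> nat).
Hypotheses (p_gt0 : 0 < p) (p_lt1 : p < 1) (S_gt0 : forall v, (0 < S v)%N).

Let bern (x : bool) : R := if x then p else 1 - p.

Let bern_gt0 x : 0 < bern x.
Proof. by rewrite /bern; case: x => /=; rewrite ?subr_gt0. Qed.

Let weight (b : {ffun T -> bool}) : R := \prod_v bern (b v).

Let weight_gt0 b : 0 < weight b.
Proof. by apply: prodr_gt0 => v _; apply: bern_gt0. Qed.

Definition two_point_mean (F : {ffun T -> bool} -> R) : R :=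
  \sum_b weight b * F b.

Definition two_point_size (b : {ffun T -> bool}) (v : T) : nat :=
  if b v then S v else 0%N.

Definition two_point_pmf (v : T) (k : nat) : R :=
  if k == 0%N then 1 - p else if k == S v then p else 0.

Local Notation E := two_point_mean.

Lemma two_point_pmf_ge0 v k : 0 <= two_point_pmf v k.
Proof. by rewrite /two_point_pmf; do 2?case: ifP => _ //; rewrite ?subr_ge0 ltW. Qed.

Lemma two_point_pmf_sum1 v :
  \esum_(k in [set: nat]) (two_point_pmf v k)%:E = 1%E.
Proof.
have Sv := S_gt0 v.
rewrite (@esum_seq _ _ [:: 0%N; S v]).
- rewrite big_cons big_seq1 /two_point_pmf eqxx (gtn_eqF Sv) eqxx.
  by rewrite subrK.
- by rewrite /= inE andbT eq_sym -lt0n.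
- exact: two_point_pmf_ge0.
- move=> k; rewrite !inE negb_or => /andP[k0 kS].
  by rewrite /two_point_pmf (negbTE k0) (negbTE kS).
Qed.

Lemma ler_mean F G : (forall b, F b <= G b) -> E F <= E G.
Proof.
by move=> FG; apply: ler_sum => b _; apply: ler_wpM2l => //; apply: ltW.
Qed.

Lemma eq_mean F G : F =1 G -> E F = E G.
Proof. by move=> FG; apply: eq_bigr => b _; rewrite FG. Qed.

Lemma meanD F G : E (fun b => F b + G b) = E F + E G.
Proof. by rewrite -big_split; apply: eq_bigr => b _; rewrite mulrDr. Qed.

Lemma meanZ c F : E (fun b => c * F b) = c * E F.
Proof. by rewrite mulr_sumr; apply: eq_bigr => b _; rewrite mulrCA. Qed.

(** The indicator is a product of functions of single bits, so its mean factors over the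
    vertices. *)
Lemma mean_all_zero (A : {set T}) :
  E (fun b => [forall v in A, ~~ b v]%:R) = (1 - p) ^+ #|A|.
Proof.
pose F v (x : bool) := bern x * (if v \in A then (~~ x)%:R else 1).
transitivity (\prod_v \sum_x F v x).
  rewrite bigA_distr_bigA; apply: eq_bigr => b _.
  rewrite big_split /=; congr (_ * _).
  case: (boolP [forall v in A, ~~ b v]) => [/forall_inP bA|].
    rewrite big1 // => v _; case: ifP => // /bA.
    by case: (b v).
  case/forall_inPn => v vA; rewrite negbK => bv.
  by rewrite (bigD1 v) //= vA bv mul0r.
rewrite (eq_bigr (fun v => if v \in A then 1 - p else 1)); last first.
  by move=> v _; rewrite big_bool /F /bern; case: ifP => _ /=; ring.
by rewrite -big_mkcond prodr_const.
Qed.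

Lemma mean1 : E (fun=> 1) = 1.
Proof.
rewrite -[RHS](expr0 (1 - p)) -[in RHS](cards0 T) -mean_all_zero.
apply: eq_mean => b; case: forall_inP => // nall.
by case: nall => v; rewrite finset.inE.
Qed.

Let flip (v : T) (b : {ffun T -> bool}) : {ffun T -> bool} :=
  [ffun u => if u == v then ~~ b u else b u].

Let flipK v : involutive (flip v).
Proof.
by move=> b; apply/ffunP => u; rewrite !ffunE; case: eqP; rewrite // negbK.
Qed.

(* Independence of the bit at [v] from the others. *)
Lemma mean_cond v (F : bool -> {ffun T -> bool} -> R) :
  (forall x (b b' : {ffun T -> bool}), (forall u, u != v -> b u = b' u) ->
     F x b = F x b') ->
  E (fun b : {ffun T -> bool} => F (b v) b) = (1 - p) * E (F false) + p * E (F true).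
Proof.
move=> F_indep.
pose rest (b : {ffun T -> bool}) := \prod_(u | u != v) bern (b u).
pose A x y := \sum_(b : {ffun T -> bool} | b v == y) rest b * F x b.
(* Flipping the bit at [v] is a bijection that preserves [rest] and [F x], so [A x] does not depend
   on the value [y] of that bit. *)
have A_flip x y : A x y = A x (~~ y).
  rewrite /A (reindex_inj (inv_inj (flipK v))) /=.
  apply: eq_big => [b|b _]; first by rewrite ffunE eqxx; case: (b v); case: y.
  congr (_ * _); last by apply: F_indep => u uv; rewrite ffunE (negbTE uv).
  by apply: eq_bigr => u uv; rewrite ffunE (negbTE uv).
have meanE x0 x1 (G : {ffun T -> bool} -> R) :
    (forall b : {ffun T -> bool}, b v = false -> G b = F x0 b) ->
    (forall b : {ffun T -> bool}, b v = true -> G b = F x1 b) ->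
    E G = (1 - p) * A x0 false + p * A x1 true.
  move=> G0 G1; rewrite /E (bigID (fun b : {ffun T -> bool} => b v == false)) /=.
  have weightE b : weight b = bern (b v) * rest b by rewrite /weight (bigD1 v).
  congr (_ + _); rewrite mulr_sumr; apply: eq_big => [b|b]; try by case: (b v).
    by move=> /eqP bv; rewrite weightE bv G0 // mulrA.
  by case bv: (b v) => // _; rewrite weightE bv G1 // mulrA.
rewrite (meanE false true) => [|b ->|b ->] //.
rewrite (meanE false false) // (meanE true true) //.
by rewrite (A_flip false true) (A_flip true false) /=; ring.
Qed.

Lemma esum_two_point (G : (T -> nat) -> R) : (forall s, 0 <= G s) ->
  (forall s s', s =1 s' -> G s = G s') ->
  \esum_(s in [set: {ffun T -> nat}])
    ((\prod_v two_point_pmf v (s v)) * G s)%:E =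
  (E (fun b => G (two_point_size b)))%:E.
Proof.
move=> G_ge0 G_ext.
pose sz (b : {ffun T -> bool}) : {ffun T -> nat} := [ffun v => two_point_size b v].
have S0 v : (S v == 0%N) = false by rewrite eqn0Ngt S_gt0.
have sz_inj : injective sz.
  move=> b b' /ffunP bb'; apply/ffunP => v; move: (bb' v).
  rewrite !ffunE /two_point_size.
  by case: (b v); case: (b' v) => // /eqP; rewrite ?S0 // eq_sym S0.
rewrite (@esum_seq _ _ (map sz (index_enum _))); last 3 first.
- by rewrite map_inj_uniq // index_enum_uniq.
- move=> s; apply: mulr_ge0 => //; apply: prodr_ge0 => v _.
  exact: two_point_pmf_ge0.
- move=> s s_out; suff /existsP[v /andP[s0 sS]] :
      [exists v, (s v != 0%N) && (s v != S v)].
    rewrite (bigD1 v) //= /two_point_pmf (negbTE s0) (negbTE sS).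
    by rewrite !mul0r.
  apply: contraNT s_out => /existsPn s_in; apply/mapP.
  (* A profile in the support is recovered from the set of its nonzero sizes. *)
  exists [ffun v => s v != 0%N]; first exact: mem_index_enum.
  apply/ffunP => v; rewrite !ffunE /two_point_size ffunE.
  by move: (s_in v); case: eqP => //= _; rewrite negbK => /eqP.
congr (_%:E); rewrite big_map; apply: eq_bigr => b _; congr (_ * _).
  apply: eq_bigr => v _; rewrite /two_point_pmf ffunE /two_point_size /bern.
  by case: (b v); rewrite ?eqxx ?S0.
by apply: G_ext => v; rewrite ffunE.
Qed.

End TwoPointSizes.

(** The sizes of jobs in [D] are never read, as these jobs are not run again; this gives the
    independence needed to condition on the first job. *)
Lemma eq_collected (R : realType) (I : orienteering R) (D : seq (vertex I))
    (T : policy (vertex I)) (s s' : vertex I -> nat) u t :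
  runs_once D T -> (forall v, v \notin D -> s v = s' v) ->
  collected s u t T = collected s' u t T.
Proof.
elim: T D u t => [|v next IH] D u t //= [vD next_once] ss'.
rewrite ss' //; congr (_ + _); apply: IH (next_once _) _ => w.
by rewrite inE negb_or => /andP[_ /ss'].
Qed.

Lemma collected_ge0 (R : realType) (I : orienteering R)
    (T : policy (vertex I)) s u t : 0 <= collected s u t T.
Proof.
elim: T u t => [|v next IH] u t //=.
by apply: addr_ge0 => //; case: ifP => // _; apply: reward_ge0.
Qed.

(** * The exponential line and the non-adaptive upper bound *)

Section ExponentialLine.
Variables (R : realType) (p : R) (N : nat) (f : nat -> nat).
Hypotheses (p_gt0 : 0 < p) (p_lt1 : p < 1).

Local Notation V := 'I_N.+1.

Definition exp_travel (u v : V) : nat := `|4 ^ u - 4 ^ v|%N.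

(* [4 ^ v] is the time left on arriving at [v] from the root if nothing was
   spent on jobs. A run of [v] of positive size leaves enough time for the jobs
   [w] with [f v < w < v] but for none with [w <= f v]. *)
Definition job_size (v : V) : nat := (2 * 4 ^ f v)%N.

(* The exponent counts the jobs [u] before [v] after whose long run [v] can
   still be reached. *)
Definition exp_reward (v : V) : R :=
  (1 - p) ^+ #|[set u : V | (v < u)%N && (f u < v)%N]%SET|.

Lemma job_size_gt0 v : (0 < job_size v)%N.
Proof. by rewrite muln_gt0 expn_gt0. Qed.

Lemma exp_travel_eq0 u v : (exp_travel u v == 0%N) = (u == v).
Proof. by rewrite /exp_travel distn_eq0 eqn_exp2l. Qed.

Lemma exp_travel_sym u v : exp_travel u v = exp_travel v u.
Proof. exact: distnC. Qed.

Lemma exp_travel_triangle u v w :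
  (exp_travel u w <= exp_travel u v + exp_travel v w)%N.
Proof. exact: leqD_dist. Qed.

Lemma exp_reward_ge0 v : 0 <= exp_reward v.
Proof. by apply: exprn_ge0; rewrite subr_ge0 ltW. Qed.

Definition exp_line : orienteering R :=
  @Orienteering R V exp_travel ord_max (4 ^ N)%N exp_reward
    (two_point_pmf p job_size) exp_travel_eq0 exp_travel_sym
    exp_travel_triangle exp_reward_ge0
    (two_point_pmf_ge0 job_size p_gt0 p_lt1)
    (two_point_pmf_sum1 p_gt0 p_lt1 job_size_gt0).

Lemma exp_line_metric : line_metric exp_line.
Proof.
exists (fun v : V => (4 ^ v)%:R) => u v /=.
rewrite /exp_travel; case: (leqP (4 ^ u) (4 ^ v)) => uv.
  by rewrite distnEr // natrB // distrC ger0_norm // subr_ge0 ler_nat.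
by rewrite distnEl ?natrB 1?ltnW // ger0_norm // subr_ge0 ler_nat ltnW.
Qed.

Local Notation E := (@two_point_mean R p V).
Local Notation sz := (two_point_size job_size).
Local Notation origin := (ord_max : vertex exp_line).

Lemma expected_reward_mean (T : policy (vertex exp_line)) :
  expected_reward T = (E (fun b => collected (I := exp_line) (sz b) origin 0 T))%:E.
Proof.
have := @esum_two_point R p V job_size p_gt0 p_lt1 job_size_gt0
  (fun s => collected (I := exp_line) s origin 0 T).
apply=> [s|s s' ss']; first exact: collected_ge0.
elim: T origin 0%N => [|v next IH] u t //=.
by rewrite ss' IH.
Qed.

Lemma exp_travel_origin (v : V) : (exp_travel ord_max v + 4 ^ v = 4 ^ N)%N.
Proof.
rewrite /exp_travel distnEl ?subnK // leq_exp2l //; exact: (leq_ord v).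
Qed.

(* Necessary condition for the reward of [v] to be collected after the jobs in
   [D] were run. *)
Definition unblocked (s : V -> nat) (D : seq V) (v : V) : bool :=
  all (fun d : V => (v < d)%N && ((f d < v)%N || (s d == 0%N))) D.

Fixpoint unblocked_reward (s : V -> nat) (D c : seq V) : R :=
  if c is v :: c' then
    (if unblocked s D v then exp_reward v else 0) + unblocked_reward s (v :: D) c'
  else 0.

(** The time hypotheses are an invariant kept by the triangle inequality: [t] covers the way from
    the root to [u], even through any [d] in [D] together with its run. *)
Lemma collected_le_unblocked (b : {ffun V -> bool}) (c D : seq V) (u : V) t :
  uniq c -> ~~ has (mem D) c ->
  (exp_travel ord_max u <= t)%N ->
  (forall d, d \in D -> (exp_travel ord_max d + sz b d + exp_travel d u <= t)%N) ->
  collected (I := exp_line) (sz b) u t (path_policy c) <=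
  unblocked_reward (sz b) D c.
Proof.
elim: c D u t => [|v c IH] D u t //= /andP[vc c_uniq].
rewrite negb_or => /andP[vD cD] ut Dt; apply: lerD; last first.
  apply: IH => //.
  - by apply/hasPn => w wc; rewrite inE negb_or (hasPn cD) // andbT;
      apply: contraNneq vc => <-.
  - by apply: leq_trans (exp_travel_triangle _ u _) _; lia.
  - move=> d; rewrite inE => /predU1P[->|/Dt].
      have := exp_travel_triangle ord_max u v.
      have -> : exp_travel v v = 0%N by apply/eqP; rewrite exp_travel_eq0.
      lia.
    by have := exp_travel_triangle d u v; lia.
case: ifP => [in_budget|_]; last by case: ifP => // _; apply: exp_reward_ge0.
suff -> : unblocked (sz b) D v by [].
apply/allP => d dD; have := Dt _ dD; have := exp_travel_triangle d u v.
have := exp_travel_origin d.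
have dv : d != v by apply: contraNneq vD => <-.
move=> d_origin d_tri dt.
(* Reaching [d] takes at least [4 ^ N - 4 ^ d], which leaves [4 ^ d] for its run and the way to
   [v]. *)
have /= : (sz b d + exp_travel d v <= 4 ^ d)%N by lia.
rewrite /exp_travel; case: (ltngtP v d) => [lt_vd|lt_dv|/val_inj eq_dv].
- rewrite distnEl; last by rewrite leq_exp2l // ltnW.
  move=> sz_d; apply/orP.
  have : (sz b d <= 4 ^ v)%N.
    by have : (4 ^ v <= 4 ^ d)%N; [rewrite leq_exp2l // ltnW | lia].
  rewrite /two_point_size; case: (b d); last by right.
  move=> fd; left; rewrite -(@ltn_exp2l 4) //; apply: leq_trans fd.
  by rewrite /job_size; have := expn_gt0 4 (f d); lia.
- rewrite distnEr; last by rewrite leq_exp2l // ltnW.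
  move=> sz_d.
  have : (4 ^ d.+1 <= 4 ^ v)%N by rewrite leq_exp2l.
  by rewrite expnS; have := expn_gt0 4 d; lia.
- by rewrite eq_dv eqxx in dv.
Qed.

(* Each job of [D] costs a factor [1 - p]: those with [f d < v] through the
   reward of [v], the others because they must have had size 0. *)
Lemma mean_unblocked (D : seq V) (v : V) : uniq D ->
  E (fun b => if unblocked (sz b) D v then exp_reward v else 0) <=
  (1 - p) ^+ size D.
Proof.
move=> D_uniq; have q_ge0 : 0 <= 1 - p by rewrite subr_ge0 ltW.
have q_le1 : 1 - p <= 1 by rewrite gerBl ltW.
pose A := [set d : V | (d \in D) && ~~ (f d < v)%N]%SET.
(* If [v] does not lie beyond every job of [D], it is always blocked. *)
case: (boolP (all (fun d : V => v < d)%N D)) => [lt_vD|]; last first.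
  move=> not_lt; rewrite (_ : E _ = 0) ?exprn_ge0 //.
  rewrite /two_point_mean big1 // => b _; case: ifPn; rewrite ?mulr0 //.
  move=> blk; case/negP: not_lt; apply: sub_all blk => d.
  by case/andP.
apply: (@le_trans _ _ (E (fun b => exp_reward v * [forall d in A, ~~ b d]%:R))).
  apply: ler_mean => // b; case: ifPn => [/allP blk|_]; last first.
    by apply: mulr_ge0 => //; apply: exp_reward_ge0.
  suff -> : [forall d in A, ~~ b d] by rewrite mulr1.
  apply/forall_inP => d; rewrite finset.inE => /andP[/blk /andP[_ fd] nfd].
  move: fd; rewrite (negbTE nfd) /= /two_point_size.
  by case: (b d) => //; rewrite eqn0Ngt job_size_gt0.
rewrite meanZ mean_all_zero // -exprD.
apply: ler_wiXn2l => //.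
rewrite -(card_uniqP D_uniq) -[X in (X <= _)%N](cardID [pred d : V | f d < v]%N) leq_add //.
  by apply: subset_leq_card; apply/fintype.subsetP => d;
     rewrite !inE => /andP[dD fd]; rewrite (allP lt_vD).
by apply: subset_leq_card; apply/fintype.subsetP => d; rewrite !inE andbC.
Qed.

(** Geometric series: with [q = 1 - p] and [k = size D], the first job adds at most [q ^ k], and
    [q ^ k + q ^ k.+1 / p = q ^ k / p]. *)
Lemma mean_unblocked_reward (c D : seq V) : uniq (c ++ D) ->
  E (fun b => unblocked_reward (sz b) D c) <= (1 - p) ^+ size D / p.
Proof.
elim: c D => [|v c IH] D /=.
  move=> _; rewrite /two_point_mean big1 => [|b _]; last by rewrite mulr0.
  by apply: divr_ge0; [apply: exprn_ge0; rewrite subr_ge0 ltW | apply: ltW].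
move=> vcD; rewrite meanD.
have D_uniq : uniq D by move: vcD => /andP[_]; rewrite cat_uniq => /and3P[].
apply: (@le_trans _ _ ((1 - p) ^+ size D + (1 - p) ^+ (size D).+1 / p)).
  apply: lerD; first exact: mean_unblocked.
  by apply: IH; rewrite uniq_catC /= mem_cat orbC -mem_cat -/(uniq _) uniq_catC.
rewrite exprS le_eqVlt; apply/orP; left; apply/eqP; field.
by rewrite gt_eqF.
Qed.

Lemma nonadaptive_opt_le : (nonadaptive_opt exp_line <= (p^-1)%:E)%E.
Proof.
apply: ge_ereal_sup => _ [c /= c_uniq <-].
rewrite expected_reward_mean lee_fin.
apply: (@le_trans _ _ (E (fun b => unblocked_reward (sz b) [::] c))).
  apply: ler_mean => // b; apply: collected_le_unblocked => //.
  - by rewrite -all_predC; apply/allP.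
  - by rewrite /exp_travel distnn.
by rewrite -[X in _ <= X]mul1r; apply: mean_unblocked_reward; rewrite cats0.
Qed.

Lemma adaptive_opt_ge (T : policy (vertex exp_line)) : runs_once [::] T ->
  ((E (fun b => collected (I := exp_line) (sz b) origin 0 T))%:E
     <= adaptive_opt exp_line)%E.
Proof.
move=> T_once; apply: ereal_sup_ubound; exists T => //.
exact: expected_reward_mean.
Qed.

End ExponentialLine.

(** * Arithmetic of the ternary code of the tree *)

(* The binary tree is coded by positive integers: the subtree of height [h]
   rooted at a [w] with [logn 3 w = h] occupies the block of the integers in
   ]w - 3 ^ h, w], its near subtree (run after a long job) is rooted at
   [w - 3 ^ h.-1] and its far subtree at [w - 2 * 3 ^ h.-1]. For [h = 0] the
   quotient below is 0, so that [far w = w]. *)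
Definition far (w : nat) : nat := (w - 3 ^ logn 3 w %/ 3 * 2)%N.

(** Blocks are nested: [3 ^ logn 3 u] divides [u - a], so [a] is at or below the bottom of the block
    of [u]. *)
Lemma leq_far a u k : (a < u)%N -> (3 ^ k %| a)%N -> (logn 3 u <= k)%N ->
  (a <= far u)%N.
Proof.
move=> au ka uk; rewrite /far.
have : (3 ^ logn 3 u %| u - a)%N.
  by apply: dvdn_sub; [apply: pfactor_dvdnn|apply: dvdn_trans ka; apply: dvdn_exp2l].
move/dvdn_leq; rewrite subn_gt0 => /(_ au).
have := leq_trunc_div (3 ^ logn 3 u) 3; lia.
Qed.

Lemma logn_sub_pow h w j : (0 < j < 3)%N -> (3 ^ h.+1 %| w)%N -> (0 < w)%N ->
  logn 3 (w - j * 3 ^ h)%N = h.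
Proof.
move=> j3 /dvdnP[m ->] m0.
have m_gt0 : (0 < m)%N by move: m0; rewrite muln_gt0 => /andP[].
have -> : (m * 3 ^ h.+1 - j * 3 ^ h = 3 ^ h * (3 * m - j))%N.
  by rewrite expnS mulnBr; congr (_ - _)%N; ring.
rewrite lognM ?expn_gt0 //; last by lia.
rewrite pfactorK // lognE.
suff -> : (3 %| 3 * m - j)%N = false by rewrite !andbF addn0.
by apply/negP => /dvdnP[k]; lia.
Qed.

Lemma logn_block h w u : (3 ^ h %| w)%N -> (w - 3 ^ h < u < w)%N ->
  (logn 3 u < h)%N.
Proof.
move=> hw /andP[lu uw]; rewrite ltnNge; apply/negP => hu.
have hu' : (3 ^ h %| u)%N.
  by apply: dvdn_trans (pfactor_dvdnn 3 u); apply: dvdn_exp2l.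
have /dvdn_leq : (3 ^ h %| w - u)%N by apply: dvdn_sub.
by rewrite subn_gt0 => /(_ uw); lia.
Qed.

(** * The adaptive tree policy and its expected reward *)

Fixpoint tree_policy (N h w : nat) : policy 'I_N.+1 :=
  if h is h'.+1 then
    Visit (inord w) (fun k =>
      tree_policy N h' (if k == 0%N then (w - 2 * 3 ^ h')%N else (w - 3 ^ h')%N))
  else Stop.

Fixpoint tree_value (R : realType) (p : R) (h : nat) : R :=
  if h is h'.+1 then 1 + (1 - p ^+ 2) * tree_value p h' else 0.

Lemma tree_value_ge0 (R : realType) (p : R) h : 0 < p -> p < 1 ->
  0 <= tree_value p h.
Proof.
move=> p0 p1; elim: h => //= h IH; apply: addr_ge0 => //.
by apply: mulr_ge0 => //; rewrite subr_ge0 expr_le1 // ltW.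
Qed.

(** The value is the sum of [(1 - p ^+ 2) ^+ i] for [i < h], and by Bernoulli each term is at least
    [1 - p ^+ 2 * h]. *)
Lemma tree_value_ge (R : realType) (p : R) h : 0 < p -> p < 1 ->
  h%:R * (1 - p ^+ 2 * h%:R) <= tree_value p h.
Proof.
move=> p0 p1; elim: h => [|h IH] /=; first by rewrite mul0r.
have pp : 0 <= 1 - p ^+ 2 by rewrite subr_ge0 expr_le1 // ltW.
apply: le_trans (lerD (lexx _) (ler_wpM2l pp IH)).
rewrite -natr1 -subr_ge0; set k := h%:R.
have -> : 1 + (1 - p ^+ 2) * (k * (1 - p ^+ 2 * k)) -
   (k + 1) * (1 - p ^+ 2 * (k + 1)) = p ^+ 2 * (k + 1) + (p ^+ 2 * k) ^+ 2 by ring.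
by rewrite addr_ge0 ?mulr_ge0 ?exprn_ge0 ?addr_ge0 ?ler0n // ltW.
Qed.

Section TreePolicy.
Variables (R : realType) (p : R) (N : nat).
Hypotheses (p_gt0 : 0 < p) (p_lt1 : p < 1).

Local Notation V := 'I_N.+1.
Local Notation I := (exp_line N far p_gt0 p_lt1).
Local Notation E := (@two_point_mean R p V).
Local Notation sz := (two_point_size (@job_size N far)).

Lemma tree_policy_runs_once h w (D : seq (vertex I)) :
  (w <= N)%N -> (3 ^ h <= w)%N -> {in D, forall d : V, (w < d)%N} ->
  runs_once D (tree_policy N h w).
Proof.
elim: h w D => [|h IH] w D //= wN hw Dw; rewrite expnS in hw.
have h_gt0 := expn_gt0 3 h.
split=> [|k].
  by apply/negP => /Dw; rewrite inordK ?ltnn.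
case: ifP => _; apply: IH; try lia; move=> d; rewrite inE => /predU1P[->|/Dw];
  by rewrite ?inordK //; lia.
Qed.

Let near_set (w : nat) : {set V} := [set u : V | (w < u)%N && (far u < w)%N]%SET.

Let exp_rewardE w : (w <= N)%N ->
  exp_reward p far (inord w : V) = (1 - p) ^+ #|near_set w|.
Proof. by move=> wN; rewrite /exp_reward inordK. Qed.

(* As [far] does not leave the sub-blocks, only [w] itself can be a new near ancestor at the top of one of the three
   sub-blocks of the block of [w]. *)
Let near_set_sub h w j : (0 < w)%N -> logn 3 w = h.+1 -> (0 < j < 3)%N ->
  {subset near_set (w - j * 3 ^ h) <=
     [predU [pred u : V | (u == w :> nat) && (far w < w - j * 3 ^ h)%N]
          & near_set w]}.
Proof.
move=> w0 logw j3 u; rewrite !inE => /andP[lt_u far_u].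
have hw : (3 ^ h.+1 %| w)%N by rewrite -logw pfactor_dvdnn.
case: (ltngtP u w) => [uw|wu|uw] /=; last 2 first.
- by apply: leq_trans far_u _; rewrite leq_subr.
- by move: far_u; rewrite uw => ->.
(* A node strictly inside the block of [w] has height at most [h], so its far child does not pass
   below the multiple [w - j * 3 ^ h] of [3 ^ h]. *)
move: far_u; rewrite ltnNge => /negP[]; apply: (leq_far (k := h)) => //.
  by apply: dvdn_sub; [apply: dvdn_trans hw; apply: dvdn_exp2l|apply: dvdn_mull].
by rewrite -ltnS; apply: logn_block hw _; rewrite uw andbT expnS; nia.
Qed.

Lemma exp_reward_near h (w : nat) : (w <= N)%N -> (0 < w)%N -> logn 3 w = h.+1 ->
  (1 - p) * exp_reward p far (inord w : V) <=
  exp_reward p far (inord (w - 3 ^ h) : V).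
Proof.
move=> wN w0 logw; rewrite !exp_rewardE //; last by lia.
rewrite -exprS; apply: ler_wiXn2l; [by rewrite subr_ge0 ltW|by rewrite gerBl ltW|].
have sub : near_set (w - 3 ^ h) \subset (inord w : V) |: near_set w.
  apply/fintype.subsetP => u; rewrite -{1}[(3 ^ h)%N]mul1n.
  move=> /(@near_set_sub h w 1 w0 logw isT); rewrite inE in_setU1 => /orP[|->].
    rewrite inE => /andP[/eqP uw _]; apply/orP; left.
    by apply/eqP/val_inj; rewrite /= inordK.
  by rewrite orbT.
apply: leq_trans (subset_leq_card sub) _; rewrite cardsU1.
by case: (_ \notin _).
Qed.

(** Here [far w] is the far child itself, so the strict inequality in the exponent does not count
    [w]. *)
Lemma exp_reward_far h (w : nat) : (w <= N)%N -> (0 < w)%N -> logn 3 w = h.+1 ->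
  exp_reward p far (inord w : V) <=
  exp_reward p far (inord (w - 2 * 3 ^ h) : V).
Proof.
move=> wN w0 logw; rewrite !exp_rewardE //; last by lia.
apply: ler_wiXn2l; [by rewrite subr_ge0 ltW|by rewrite gerBl ltW|].
apply: subset_leq_card; apply/fintype.subsetP => u.
move=> /(@near_set_sub h w 2 w0 logw isT); rewrite inE => /orP[|//].
by rewrite inE => /andP[_]; rewrite /far logw expnS mulKn // mulnC ltnn.
Qed.

(* The last hypothesis says that the time spent on jobs so far is at most
   3 * 4 ^ (w - 3 ^ h), where w - 3 ^ h is the bottom of the block of [w]. *)
Lemma tree_policy_ge h w (u : vertex I) t :
  (0 < w <= N)%N -> logn 3 w = h ->
  (t + exp_travel u (inord w : V) <=
     exp_travel ord_max (inord w : V) + 3 * 4 ^ (w - 3 ^ h))%N ->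
  exp_reward p far (inord w : V) * tree_value p h <=
  E (fun b => collected (I := I) (sz b) u t (tree_policy N h w)).
Proof.
elim: h w u t => [|h IH] w u t /andP[w0 wN] logw tw /=.
  rewrite mulr0 /two_point_mean big1 // => b _; exact: mulr0.
have hw : (3 ^ h.+1 %| w)%N by rewrite -logw pfactor_dvdnn.
have le_hw := dvdn_leq w0 hw; rewrite expnS in le_hw.
have h_gt0 := expn_gt0 3 h; rewrite /= in h_gt0.
have far_w : far w = (w - 2 * 3 ^ h)%N.
  by rewrite /far logw expnS mulKn // mulnC.
pose v : V := inord w; have vE : v = w :> nat by rewrite inordK.
have pow_a : (4 * 4 ^ (w - 3 ^ h.+1) <= 4 ^ far w)%N.
  by rewrite -expnS leq_exp2l // far_w expnS; lia.
have pow_w : (4 * 4 ^ far w <= 4 ^ w)%N.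
  by rewrite -expnS leq_exp2l // far_w; lia.
have := exp_travel_origin v; rewrite vE => orig_v.
rewrite -/v in tw.
(* With [a] the bottom of the block, [3 * 4 ^ a + 2 * 4 ^ far w <= 3 * 4 ^ far w <= 4 ^ w]. *)
have in_budget : (t + exp_travel u v + 2 * 4 ^ far w <= 4 ^ N)%N by lia.
pose next (x : bool) : policy V := tree_policy N h (if x then w - 3 ^ h else w - 2 * 3 ^ h)%N.
pose t' (x : bool) : nat := (t + exp_travel u v + (if x then 2 * 4 ^ far w else 0))%N.
have szE b : sz b v = (if b v then 2 * 4 ^ far w else 0)%N.
  by rewrite /two_point_size /job_size vE.
have next_once x : runs_once [:: v : vertex I] (next x).
  apply: tree_policy_runs_once; try by case: x; lia.
  by move=> d; rewrite inE => /eqP ->; rewrite vE; case: x; lia.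
rewrite (@eq_mean _ _ _ _ (fun b => exp_reward p far v +
    collected (I := I) (sz b) v (t' (b v)) (next (b v)))); last first.
  move=> b /=; rewrite -/v szE /t' /next.
  have s0 : (2 * 4 ^ far w == 0)%N = false by rewrite muln_eq0 expn_eq0.
  case: (b v); rewrite ?s0 ?eqxx /=; rewrite ifT //;
    by apply: leq_trans in_budget; lia.
rewrite meanD.
have -> : E (fun=> exp_reward p far v) = exp_reward p far v.
  rewrite -[RHS]mulr1 -[X in _ = _ * X](mean1 p V) -meanZ.
  by apply: eq_mean => b; rewrite mulr1.
rewrite (@mean_cond _ _ _ _ (fun x b => collected (I := I) (sz b) v (t' x) (next x))).
  2: { move=> x b b' bb' /=.
       apply: (eq_collected (I := I) v (t' x) (next_once x)) => i.
       by rewrite inE => iv; rewrite /two_point_size bb'. }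
have step x : forall w' : nat, w' = (if x then w - 3 ^ h else w - 2 * 3 ^ h)%N ->
    exp_reward p far (inord w' : V) * tree_value p h <=
    E (fun b => collected (I := I) (sz b) v (t' x) (next x)).
  move=> w' w'E; rewrite /next -w'E; apply: IH.
  - by rewrite w'E; case: x {w'E}; lia.
  - rewrite w'E; case: x {w'E}; last exact: logn_sub_pow.
    by rewrite -[X in (_ - X)%N]mul1n logn_sub_pow.
  - have w'w : (w' < w)%N by rewrite w'E; case: x {w'E}; lia.
    have := exp_travel_origin (inord w' : V); rewrite inordK; last by lia.
    rewrite {2}/exp_travel vE inordK; last by lia.
    have : (4 ^ w' <= 4 ^ w)%N by rewrite leq_exp2l // ltnW.
    move=> pw'; rewrite distnEl // /t'.
    (* The far block has the same bottom as that of [w]; the near block has bottom [far w], whose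
       larger allowance absorbs the long run. *)
    have powx : (3 * 4 ^ (w - 3 ^ h.+1) + (if x then 2 * 4 ^ far w else 0) <=
                 3 * 4 ^ (w' - 3 ^ h))%N.
      case: x w'E => ->.
        by rewrite (_ : w - 3 ^ h - 3 ^ h = far w)%N; lia.
      by rewrite (_ : w - 2 * 3 ^ h - 3 ^ h = w - 3 ^ h.+1)%N ?expnS; lia.
    lia.
have V_ge0 := tree_value_ge0 h p_gt0 p_lt1.
have q_gt0 : 0 < 1 - p by rewrite subr_gt0.
apply: le_trans (lerD (lexx _) (lerD (ler_wpM2l (ltW q_gt0) (step false _ erefl))
                                     (ler_wpM2l (ltW p_gt0) (step true _ erefl)))).
have near_le := exp_reward_near wN w0 logw.
have far_le := exp_reward_far wN w0 logw.
apply: le_trans (lerD (lexx _)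
  (lerD (ler_wpM2l (ltW q_gt0) (ler_wpM2r V_ge0 far_le))
        (ler_wpM2l (ltW p_gt0) (ler_wpM2r V_ge0 near_le)))).
by rewrite -/v le_eqVlt; apply/orP; left; apply/eqP; ring.
Qed.

End TreePolicy.

(** * Choice of parameters and the gap *)

Section Gap.
Variables (R : realType) (m : nat).
Hypothesis m_gt0 : (0 < m)%N.

Let p : R := (2 * m%:R)^-1.
Let N := (3 ^ (m ^ 2))%N.

Let m_ge1 : 1 <= m%:R :> R.
Proof. by rewrite ler1n. Qed.

Let p_gt0 : 0 < p.
Proof. by rewrite invr_gt0 mulr_gt0 // ltr0n. Qed.

Let p_lt1 : p < 1.
Proof. by rewrite invf_lt1; have := m_ge1; lra. Qed.

Let three_le_N : (3 <= N)%N.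
Proof. by rewrite -[X in (X <= _)%N]expn1 leq_exp2l // expn_gt0 m_gt0. Qed.

Definition gap_instance : orienteering R := exp_line N far p_gt0 p_lt1.

Lemma gap_nonadaptive_gt0 : (0 < nonadaptive_opt gap_instance)%E.
Proof.
(* The least code of height 1: its tree policy is a single visit. *)
pose v : 'I_N.+1 := inord 3.
have path_gt0 : (0 < expected_reward (path_policy [:: v : vertex gap_instance]))%E.
  rewrite expected_reward_mean lte_fin.
  have value_gt0 : 0 < exp_reward p far v * tree_value p 1.
    rewrite /= mulr0 addr0 mulr1; apply: exprn_gt0.
    by rewrite subr_gt0.
  apply: (lt_le_trans value_gt0).
  apply: (@tree_policy_ge _ _ _ p_gt0 p_lt1 1 3) => //.
  by rewrite add0n leq_addr.
apply: (lt_le_trans path_gt0); apply: ereal_sup_ubound.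
by exists [:: v].
Qed.

Lemma gap_nonadaptive_le : (nonadaptive_opt gap_instance <= (2 * m%:R)%:E)%E.
Proof. by rewrite -[2 * m%:R]invrK; apply: nonadaptive_opt_le. Qed.

Lemma gap_adaptive_ge :
  ((3 / 4 * m%:R ^+ 2)%:E <= adaptive_opt gap_instance)%E.
Proof.
have NE : inord N = ord_max :> 'I_N.+1 by apply/val_inj; rewrite /= inordK.
have T_once : runs_once (V := vertex gap_instance) [::] (tree_policy N (m ^ 2) N).
  exact: tree_policy_runs_once.
apply: le_trans (adaptive_opt_ge T_once); rewrite lee_fin.
have reward_root : exp_reward p far (inord N : 'I_N.+1) = 1.
  rewrite NE /exp_reward (_ : #|_| = 0%N) //; apply/eqP; rewrite cards_eq0.
  apply/eqP/setP => u; rewrite !inE; apply/negbTE/negP => /andP[].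
  by rewrite ltnNge (leq_ord u).
have value_ge : 3 / 4 * m%:R ^+ 2 <=
    exp_reward p far (inord N : 'I_N.+1) * tree_value p (m ^ 2).
  rewrite reward_root mul1r; apply: le_trans (tree_value_ge _ p_gt0 p_lt1).
  (* With [h = m ^ 2], [p ^+ 2 * h = 1 / 4]. *)
  rewrite natrX le_eqVlt; apply/orP; left; apply/eqP; rewrite /p.
  by field; have := m_ge1; lra.
apply: (le_trans value_ge).
apply: (@tree_policy_ge _ _ _ p_gt0 p_lt1); rewrite ?pfactorK //.
- by rewrite expn_gt0 leqnn.
- by rewrite add0n leq_addr.
Qed.

(** By [ln (k + 1) <= k], [ln (4 ^ N) <= 3 * N = 3 ^ (m ^ 2).+1], whose logarithm is at most
    [2 * (m ^ 2).+1 <= (2 * m) ^ 2]. *)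
Lemma sqrt_ln_ln_budget_le :
  Num.sqrt (ln (ln (budget gap_instance)%:R)) <= 2 * m%:R :> R.
Proof.
have lnX_le (k n : nat) : ln ((k.+1 ^ n)%:R : R) <= (k * n)%:R.
  rewrite natrX lnXn ?ltr0n // natrM -[leLHS]mulr_natr.
  apply: ler_wpM2r => //; rewrite -natr1 addrC; apply: le_ln1Dx.
  by have := ler0n R k; lra.
have lnB_gt0 : 0 < ln ((4 ^ N)%:R : R).
  by rewrite ln_gt0 // ltr1n -[X in (X < _)%N](expn0 4) ltn_exp2l // expn_gt0.
have ln_ln_le : ln (ln ((4 ^ N)%:R : R)) <= (2 * (m ^ 2).+1)%:R.
  apply: le_trans (lnX_le 2%N _); rewrite ler_ln ?posrE ?ltr0n ?expn_gt0 //.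
  by rewrite expnS; apply: lnX_le.
apply: (@le_trans _ _ (Num.sqrt ((2 * m%:R) ^+ 2))); last first.
  by rewrite sqrtr_sqr ger0_norm // mulr_ge0.
apply: ler_wsqrtr; apply: le_trans ln_ln_le _.
rewrite -[X in _ <= X ^+ _]natrM -natrX ler_nat; nia.
Qed.

End Gap.

Theorem theorem1 (R : realType) :
  exists c : R, 0 < c /\
    forall B0 : nat, exists B : nat, (B0 <= B)%N /\
      exists I : orienteering R,
        [/\ budget I = B,
            line_metric I,
            (0 < nonadaptive_opt I)%E
          & ((c * Num.sqrt (ln (ln B%:R)))%:E * nonadaptive_opt I
               <= adaptive_opt I)%E].
Proof.
(* The constant solves [c * (2 * m) * (2 * m) = 3 / 4 * m ^ 2]. *)
exists (3 / 16); split=> [|B0]; first by lra.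
pose I := gap_instance R (ltn0Sn B0).
exists (budget I); split.
  rewrite /=; apply: leq_trans (ltnW (ltn_expl _ _)) => //.
  apply: leq_trans (ltnW (ltn_expl _ _)) => //; nia.
exists I; split=> //; [exact: exp_line_metric|exact: gap_nonadaptive_gt0|].
apply: le_trans (gap_adaptive_ge R (ltn0Sn B0)).
have sqrt_ge0 : 0 <= 3 / 16 * Num.sqrt (ln (ln (budget I)%:R)) :> R.
  by rewrite mulr_ge0 ?sqrtr_ge0 //; lra.
have := gap_nonadaptive_le R (ltn0Sn B0).
move/(lee_wpmul2l (_ : (0 <= (3 / 16 * Num.sqrt (ln (ln (budget I)%:R)))%:E)%E)).
rewrite lee_fin => /(_ sqrt_ge0) /le_trans; apply.
rewrite -EFinM lee_fin.
have := @sqrt_ln_ln_budget_le R _ (ltn0Sn B0); rewrite -/I.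
have := ler0n R B0.+1.
by move: (B0.+1%:R) (Num.sqrt _) => x y x0 yx; nra.
Qed.
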